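(* Let $q\ge2$ be an integer and let $0<p<\frac{q-1}{q}$. There exists a constant $c=c_{p,q}>0$, depending only on $p$ and $q$, such that for every positive integer $n$ for which $d=pn$ is an integer, the number of $q$-ary length-$n$ codes with minimum distance at least $d+1$ is at least $$\exp\left(cn^2\cdot\frac{q^n}{\mathrm{vol}_q(n,d)}\right).$$
   Context: A $q$-ary code of length $n$ is a subset $\mathcal C\subseteq[q]^n$; it has minimum distance at least $m$ if any two distinct elements of $\mathcal C$ have Hamming distance (number of coordinates in which they differ) at least $m$. $\mathrm{vol}_q(n,d)=\sum_{i=0}^d\binom ni(q-1)^i$ is the volume of a radius-$d$ Hamming ball in $[q]^n$. *)

(* Defs.v *)
From mathcomp Require Import all_boot.

Set Implicit Arguments.
Unset Strict Implicit.
Unset Printing Implicit Defensive.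

Definition word (q n : nat) := {ffun 'I_n -> 'I_q}.

Definition hamming_dist (q n : nat) (x y : word q n) : nat :=
  #|[set i | x i != y i]|.

Definition min_dist_geq (q n m : nat) (C : {set word q n}) : bool :=
  [forall x in C, forall y in C, (x != y) ==> (m <= hamming_dist x y)].

Definition codes (q n m : nat) : {set {set word q n}} :=
  [set C | min_dist_geq m C].

Definition vol (q n d : nat) : nat :=
  \sum_(0 <= i < d.+1) 'C(n, i) * (q - 1) ^ i.

(* Main.v *)
Require Import Defs.
From mathcomp Require Import all_boot all_order all_algebra.
From mathcomp Require Import reals sequences exp.
From mathcomp Require Import zify ring lra.
Import Order.TTheory GRing.Theory Num.Theory.

Set Implicit Arguments.
Unset Strict Implicit.
Unset Printing Implicit Defensive.

(** A code of minimum distance at least [d + 1] is an independent set of the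
    graph on the [N = q ^ n] words in which two distinct words are joined when
    their distance is at most [d].  Closed neighbourhoods are Hamming balls, of
    size [V = vol q n d].  The theorem follows from one feature of this graph:
    it has exponentially few triangles.

    Few triangles ([local_sparsity]).  For [d = p n] with [p < (q - 1) / q], two
    random words of a ball are typically at distance about [theta n] with
    [theta = p (2 - p q / (q - 1)) > p], so only an [exp (- kappa n)] fraction of
    the pairs in a ball is at distance at most [d].  This is a Chernoff bound:
    give the words the product measure under which each letter of the centre is
    kept with probability [1 - p].  Every word of the ball then has at least the
    weight of a word on its boundary, which by [binomial_mode] is at least
    [1 / ((n + 1) V)]; and the moment of [u ^ distance] of two independent words
    factors over the coordinates ([tilted_pair_sum]).

    From few triangles to many independent sets ([many_stable_sets]).  Sample
    about [M = 4 ^ k N / V] vertices uniformly and independently, with [k] a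
    small multiple of [n].  At this density the expected degree in the sample is
    about [4 ^ k], while triangles are so rare that a vertex of the sample rarely
    lies on one.  So for at least half of the samples, at least half of the
    vertices of the sample span a triangle-free graph of maximum degree at most
    [8 * 4 ^ k].  Such a graph has an independent set of size of order
    [k M / 4 ^ k], that is, of order [t = k N / V]
    ([triangle_free_stable_set], a logarithmic gain over the greedy bound).  A
    given set of [t] words is hit by a sample with probability at most about
    [(M / N) ^ t] ([card_stable_samples]), which is at most [4 ^ (- k t)] up to
    constant factors, and half of all samples hit some independent set of size
    [t] ([many_good_samples]): hence there are at least [4 ^ (k t)] of them.
    As [k] is linear in [n], [k t] is of order [n ^ 2 N / V].

    For the finitely many [n] below the threshold of these estimates, it is
    enough that there are two codes. *)

(** * Independent sets in triangle-free graphs *)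

Definition stable (T : finType) (e : rel T) (W : {set T}) : bool :=
  [forall x in W, forall y in W, ~~ e x y].

Lemma stableP (T : finType) (e : rel T) (W : {set T}) :
  reflect {in W &, forall x y, ~~ e x y} (stable e W).
Proof.
apply: (iffP forall_inP) => [h x y xW yW | h x xW].
  by move/forall_inP: (h x xW) => /(_ y yW).
by apply/forall_inP => y yW; apply: h.
Qed.

Lemma stable_subset (T : finType) (e : rel T) (W W' : {set T}) :
  W' \subset W -> stable e W -> stable e W'.
Proof.
move=> /subsetP sub /stableP h; apply/stableP => x y xW yW.
by apply: h; apply: sub.
Qed.

(** Complementation in [A] pairs each subset with one of complementary size, so
    the average size is half of [#|A|]. *)
Lemma sum_card_powerset (T : finType) (A : {set T}) :
  2 * (\sum_(B in powerset A) #|B|) = #|A| * 2 ^ #|A|.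
Proof.
have cmpl : \sum_(B in powerset A) #|B| = \sum_(B in powerset A) #|A :\: B|.
  rewrite (reindex_onto (fun B => A :\: B) (fun B => A :\: B)) /=; last first.
    by move=> B; rewrite powersetE => BA; rewrite setDDr setDv set0U (setIidPr BA).
  apply: eq_bigl => B; rewrite !powersetE subsetDl /= setDDr setDv set0U.
  by apply/eqP/idP => [/setIidPr|/setIidPr].
rewrite mul2n -addnn {2}cmpl -big_split /=.
rewrite (eq_bigr (fun=> #|A|)) => [|B]; last first.
  by rewrite powersetE => /setIidPr BA; rewrite -(cardsID B A) BA.
by rewrite sum_nat_const card_powerset mulnC.
Qed.

(** The two terms on the right balance each other: if few neighbours are
    available ([x <= k]) then the vertex itself is chosen often enough, and
    otherwise a uniform set of neighbours has average size [x / 2 >= k / 2]. *)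
Lemma local_occupancy_arith (k D x : nat) :
  4 ^ k <= D -> (1 + 2 ^ x) * k <= 4 * D + 2 * (x * 2 ^ x).
Proof.
move=> kD; have [le_xk | /ltnW le_kx] := leqP x k.
  have le2 : 2 ^ x <= 2 ^ k by rewrite leq_exp2l.
  have ltk : k <= 2 ^ k by apply/ltnW/ltn_expl.
  have e4 : 4 ^ k = 2 ^ k * 2 ^ k by rewrite -expnMn.
  have p2 : 0 < 2 ^ k by rewrite expn_gt0.
  nia.
have p2 : 0 < 2 ^ x by rewrite expn_gt0.
nia.
Qed.

(** For a uniformly random independent set [W] of the graph on [S], the weight
    [D * [v in W] + #|N(v) :&: W|] has expectation at least [k / 4].  This holds
    even conditionally on the part [h] of [W] outside the closed neighbourhood of
    [v]: as there is no triangle, the neighbours of [v] that have no neighbour in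
    [h] form an independent set [A], so given [h] the set [W] is either
    [h] with [v] added, or [h] with an arbitrary subset of [A] added. *)
Lemma local_occupancy (T : finType) (e : rel T) (S : {set T}) (D k : nat) (v : T) :
  symmetric e -> irreflexive e ->
  {in S & S & S, forall x y z, ~~ [&& e x y, e x z & e y z]} ->
  4 ^ k <= D -> v \in S ->
  \sum_(W in powerset S | stable e W) k <=
  \sum_(W in powerset S | stable e W)
     4 * (D * (v \in W) + #|[set u in S | e v u] :&: W|).
Proof.
move=> es ei tf kD vS; set Nv := [set u in S | e v u].
rewrite (partition_big (fun W => W :\: (v |: Nv)) predT) //=.
rewrite [leqRHS](partition_big (fun W => W :\: (v |: Nv)) predT) //=.
apply: leq_sum => h _.
pose P W := ((W \in powerset S) && stable e W) && (W :\: (v |: Nv) == h).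
rewrite -!/(P _).
have [W0 PW0 | none] := pickP P; last first.
  by rewrite big_pred0.
have vNv : v \notin Nv by rewrite inE ei andbF.
have NvS u : u \in Nv -> u \in S by rewrite inE => /andP[].
have [W0S [stW0 defh]] : W0 \subset S /\ stable e W0 /\ W0 :\: (v |: Nv) = h.
  by move: PW0 => /andP[/andP[+ ?] /eqP ?]; rewrite powersetE.
have hW0 : h \subset W0 by rewrite -defh subsetDl.
have hS : h \subset S by apply: subset_trans hW0 W0S.
have sth : stable e h by apply: stable_subset hW0 stW0.
have hN u : u \in h -> (u != v) && (u \notin Nv).
  by rewrite -defh !inE negb_or => /andP[].
have vh : v \notin h by apply/negP => /hN; rewrite eqxx.
have hv u : u \in h -> ~~ e v u.
  move=> uh; have := hN u uh; rewrite inE (subsetP hS) //=.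
  by case/andP.
set A := [set u in Nv | [forall w in h, ~~ e u w]].
have fibre W : P W = (W \in (v |: h) |: [set h :|: B | B in powerset A]).
  apply/idP/idP => [/andP[/andP[+ stW] /eqP defhW]|].
    rewrite powersetE => WS; rewrite in_setU1; have [vW | vW] := boolP (v \in W).
      apply/orP; left; apply/eqP/setP => u; rewrite -defhW !inE.
      have [-> | uv] //= := eqVneq u v.
      have [uW | uW] := boolP (u \in W); last by rewrite andbF.
      by rewrite (negPf (stableP _ _ stW v u vW uW)) andbF.
    apply/orP; right; apply/imsetP; exists (W :&: Nv).
      rewrite powersetE; apply/subsetP => u; rewrite inE => /andP[uW uN].
      rewrite inE uN /=; apply/forall_inP => w; rewrite -defhW inE => /andP[_ wW].
      exact: (stableP _ _ stW).
    apply/setP => u; rewrite -defhW !inE.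
    have [-> | uv] //= := eqVneq u v; first by rewrite (negPf vW) vS ei.
    by case: (u \in W); rewrite ?andbF //= !andbT orNb.
  rewrite in_setU1 => /orP[/eqP -> | /imsetP[B + ->]].
    rewrite /P powersetE subUset sub1set vS hS /=; apply/andP; split.
      apply/stableP => x y; rewrite !in_setU1.
      move=> /orP[/eqP -> | xh] /orP[/eqP -> | yh]; rewrite ?ei ?hv //.
        by rewrite es hv.
      exact: (stableP _ _ sth).
    apply/eqP/setP => u; rewrite in_setD !in_setU1.
    have [-> | uv] //= := eqVneq u v; first by rewrite (negPf vh).
    by have [/hN | ] := boolP (u \in h); rewrite ?andbF //= => /andP[_ ->].
  rewrite powersetE => /subsetP BA.
  have BN u : u \in B -> u \in Nv by move/BA; rewrite inE => /andP[].
  rewrite /P powersetE subUset hS /=; apply/andP; split; first (apply/andP; split).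
  - by apply/subsetP => u /BN /NvS.
  - have Bh x y : x \in B -> y \in h -> ~~ e x y.
      by move=> /BA; rewrite inE => /andP[_ /forall_inP]; apply.
    apply/stableP => x y; rewrite !in_setU.
    move=> /orP[xh | xB] /orP[yh | yB]; last 1 first.
    + have := tf v x y vS (NvS _ (BN _ xB)) (NvS _ (BN _ yB)).
      by have := BN _ xB; have := BN _ yB; rewrite !inE => /andP[_ ->] /andP[_ ->].
    + exact: (stableP _ _ sth).
    + by rewrite es Bh.
    + exact: Bh.
  - apply/eqP/setP => u; rewrite in_setD in_setU1 in_setU.
    have [/hN /andP[/negPf -> /negPf ->] | uh] //= := boolP (u \in h).
    have [/BN -> | _] := boolP (u \in B); first by rewrite orbT.
    by rewrite andbF.
have vB : (v |: h) \notin [set h :|: B | B in powerset A].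
  apply/imsetP => -[B]; rewrite powersetE => /subsetP BA /setP /(_ v).
  rewrite in_setU1 eqxx in_setU (negPf vh) /= => /esym/BA.
  by rewrite inE (negPf vNv).
have injU : {in powerset A &, injective (fun B => h :|: B)}.
  move=> B B'; rewrite !powersetE => /subsetP BA /subsetP BA' /setP eqB.
  apply/setP => u; have := eqB u; rewrite !in_setU.
  have [/hN /andP[_ uN] _ | //] := boolP (u \in h).
  have nB (C : {set T}) : {subset C <= A} -> u \notin C.
    by move=> CA; apply: contra uN => /CA; rewrite inE => /andP[].
  by rewrite (negPf (nB _ BA)) (negPf (nB _ BA')).
rewrite !(eq_bigl _ _ fibre) !big_setU1 //= !big_imset //=.
rewrite sum_nat_const card_powerset setU11 muln1.
have -> : \sum_(B in powerset A) 4 * (D * (v \in h :|: B) + #|Nv :&: (h :|: B)|)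
        = 2 * (#|A| * 2 ^ #|A|).
  rewrite -sum_card_powerset mulnA big_distrr /=; apply: eq_bigr => B.
  rewrite powersetE => /subsetP BA.
  have BN u : u \in B -> u \in Nv by move/BA; rewrite inE => /andP[].
  rewrite in_setU (negPf vh) /=.
  have [/BN | _] := boolP (v \in B); first by rewrite (negPf vNv).
  rewrite muln0 add0n; congr (4 * #|pred_of_set _|); apply/setP => u.
  rewrite in_setI in_setU; have [/hN /andP[_ uN] | uh] /= := boolP (u \in h).
    by rewrite (negPf uN); apply/esym/negP => /BN; rewrite (negPf uN).
  by apply/andP/idP => [[]|uB] //; split => //; apply: BN.
have := local_occupancy_arith #|A| kD.
by rewrite mulnDl mul1n; lia.
Qed.

(** Summing the weights of [local_occupancy] over all [v] counts each element of
    [W] at most [2 * D] times, [D] times for itself and once for each of its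
    neighbours.  So the average independent set already has the required size,
    which exceeds the greedy bound [#|S| / D] by a factor of order [log D]. *)
Lemma triangle_free_stable_set (T : finType) (e : rel T) (S : {set T}) (D k : nat) :
  symmetric e -> irreflexive e ->
  {in S & S & S, forall x y z, ~~ [&& e x y, e x z & e y z]} ->
  {in S, forall v, #|[set u in S | e v u]| <= D} -> 4 ^ k <= D ->
  exists W : {set T}, [/\ W \subset S, stable e W & #|S| * k <= 8 * D * #|W|].
Proof.
move=> es ei tf deg kD.
have : \sum_(v in S) \sum_(W in powerset S | stable e W) k <=
    \sum_(W in powerset S | stable e W) 8 * D * #|W|.
  apply: (@leq_trans (\sum_(v in S) \sum_(W in powerset S | stable e W)
     4 * (D * (v \in W) + #|[set u in S | e v u] :&: W|))).
    by apply: leq_sum => v vS; apply: local_occupancy.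
  rewrite exchange_big /=; apply: leq_sum => W /andP[+ _].
  rewrite powersetE => WS.
  rewrite -big_distrr /= big_split /= -big_distrr /=.
  have -> : \sum_(v in S) (v \in W : nat) = #|W|.
    by rewrite -big_mkcondr -sum1_card /=; apply: eq_bigl => v; 
       have [/(subsetP WS) -> | //] := boolP (v \in W); rewrite ?andbF.
  have : \sum_(v in S) #|[set u in S | e v u] :&: W| <= #|W| * D.
    rewrite (eq_bigr (fun v => \sum_(w in W) (e v w : nat))) => [|v vS]; last first.
      rewrite -big_mkcondr -sum1_card /=; apply: eq_bigl => w; rewrite !inE.
      by have [/(subsetP WS) -> | //] := boolP (w \in W); rewrite ?andbF ?andbT.
    rewrite exchange_big -sum_nat_const /=; apply: leq_sum => w wW.
    rewrite -big_mkcondr sum1_card; apply: leq_trans (deg w (subsetP WS _ wW)).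
    by apply/eq_leq/eq_card => u; rewrite !inE es.
  lia.
rewrite exchange_big /= => le_sum.
have [W /and3P[WS stW bW] | none] :=
  pickP (fun W => [&& W \in powerset S, stable e W & #|S| * k <= 8 * D * #|W|]).
  by exists W; rewrite -powersetE; split.
have st0 : (set0 \in powerset S) && stable e set0.
  by rewrite powersetE sub0set; apply/stableP => x y; rewrite inE.
move: le_sum; rewrite leqNgt => /negP; case.
have lt W : (W \in powerset S) && stable e W -> 8 * D * #|W| < \sum_(v in S) k.
  move=> /andP[WS stW]; rewrite sum_nat_const ltnNge.
  by have := none W; rewrite WS stW => /= ->.
rewrite (bigD1 set0) //= [ltnRHS](bigD1 set0) //= -addSn.
apply: leq_add; first exact: lt.
by apply: leq_sum => W /andP[/lt/ltnW].
Qed.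

(** * Independent sets in random samples of a graph *)

(** For [f = id] this is the graph of [r] without loops.  For a sample [f] the
    vertices are the indices, so that two indices with the same value are
    adjacent when [r] is reflexive, and [f] is injective on independent sets. *)
Definition distinct_close (X : Type) (A : eqType) (r : rel X) (f : A -> X) : rel A :=
  fun i j => (i != j) && r (f i) (f j).

Lemma card_ffun_into (I X : finType) (J : {set I}) (F : I -> {set X}) :
  #|[set f : {ffun I -> X} | [forall i in J, f i \in F i]]|
  = (\prod_(i in J) #|F i|) * #|X| ^ (#|I| - #|J|).
Proof.
pose G i := if i \in J then F i else [set: X].
have -> : #|[set f : {ffun I -> X} | [forall i in J, f i \in F i]]| = #|family G|.
  apply: eq_card => f; rewrite inE; apply/forall_inP/familyP => [h i | h i iJ].
    by rewrite /G; case: ifP => [/h // | _]; rewrite inE.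
  by have := h i; rewrite /G iJ.
rewrite card_family foldrE big_map big_enum /=.
rewrite (bigID (mem J)) /=; congr (_ * _).
  by apply: eq_bigr => i iJ; rewrite /G iJ.
rewrite (eq_bigr (fun=> #|X|)) => [|i /negPf iJ]; last by rewrite /G iJ cardsT.
rewrite prod_nat_const; congr (_ ^ _).
by rewrite -(cardC (mem J)) addKn; apply: eq_card => i; rewrite !inE.
Qed.

Lemma card_ffun_agree (I X : finType) (J : {set I}) (g : I -> X) :
  #|[set f : {ffun I -> X} | [forall i in J, f i == g i]]| * #|X| ^ #|J|
  = #|X| ^ #|I|.
Proof.
have -> : [set f : {ffun I -> X} | [forall i in J, f i == g i]]
  = [set f : {ffun I -> X} | [forall i in J, f i \in [set g i]]].
  by apply/setP => f; rewrite !inE; apply: eq_forallb => i; rewrite inE.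
rewrite card_ffun_into big1 => [|i _]; last by rewrite cards1.
by rewrite mul1n -expnD subnK // max_card.
Qed.

Lemma marginal2 (I X : finType) (P : rel X) (i j : I) : i != j ->
  #|[set f : {ffun I -> X} | P (f i) (f j)]| * #|X| ^ 2
  = #|[set a : X * X | P a.1 a.2]| * #|X| ^ #|I|.
Proof.
move=> ij; rewrite -[#|finset (fun f : {ffun I -> X} => P (f i) (f j))|]sum1_card.
rewrite -[#|[set a : X * X | P a.1 a.2]|]sum1_card.
rewrite (partition_big (fun f : {ffun I -> X} => (f i, f j))
                       (fun a => a \in [set a : X * X | P a.1 a.2])) /=; last first.
  by move=> f; rewrite !inE.
rewrite big_distrl [RHS]big_distrl /=; apply: eq_bigr => a; rewrite inE => Pa.
rewrite mul1n sum1_card.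
rewrite -(@card_ffun_agree I X [set i; j] (fun l => if l == i then a.1 else a.2)).
rewrite cards2 ij; congr (_ * _); apply: eq_card => f; rewrite !inE.
apply/andP/forall_inP => [[_ /eqP <-] l | h].
  by rewrite !inE => /orP[] /eqP ->; rewrite ?eqxx //= (negPf (_ : j != i)) // eq_sym.
have /eqP fi := h i (set21 i j); have /eqP fj := h j (set22 i j).
move: fi fj; rewrite eqxx (negPf (_ : j != i)) 1?eq_sym // => fi fj.
by rewrite inE fi fj -surjective_pairing.
Qed.

Lemma marginal3 (I X : finType) (P : X -> rel X) (i j l : I) :
  i != j -> i != l -> j != l ->
  #|[set f : {ffun I -> X} | P (f i) (f j) (f l)]| * #|X| ^ 3
  = #|[set a : X * (X * X) | P a.1 a.2.1 a.2.2]| * #|X| ^ #|I|.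
Proof.
move=> ij il jl; rewrite -[#|finset (fun f : {ffun I -> X} => P (f i) (f j) (f l))|]sum1_card.
rewrite -[#|[set a : X * (X * X) | P a.1 a.2.1 a.2.2]|]sum1_card.
rewrite (partition_big (fun f : {ffun I -> X} => (f i, (f j, f l)))
            (fun a => a \in [set a : X * (X * X) | P a.1 a.2.1 a.2.2])) /=; last first.
  by move=> f; rewrite !inE.
rewrite big_distrl [RHS]big_distrl /=; apply: eq_bigr => a; rewrite inE => Pa.
rewrite mul1n sum1_card.
rewrite -(@card_ffun_agree I X (i |: [set j; l])
           (fun m => if m == i then a.1 else if m == j then a.2.1 else a.2.2)).
rewrite cardsU1 cards2 jl !inE negb_or ij il; congr (_ * _).
have ji : (j == i) = false by apply/negbTE; rewrite eq_sym.
have li : (l == i) = false by apply/negbTE; rewrite eq_sym.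
have lj : (l == j) = false by apply/negbTE; rewrite eq_sym.
apply: eq_card => f; rewrite !inE.
apply/andP/forall_inP => [[_ /eqP <-] m | h].
  by rewrite !inE => /or3P[] /eqP ->; rewrite ?eqxx ?ji ?li ?lj ?eqxx.
have /eqP fi := h i (setU11 _ _).
have /eqP fj : _ := h j (setU1r _ (set21 _ _)).
have /eqP fl : _ := h l (setU1r _ (set22 _ _)).
move: fi fj fl; rewrite !eqxx ji li lj => fi fj fl.
by rewrite inE fi fj fl -!surjective_pairing.
Qed.

Definition degree (I : finType) (e : rel I) (i : I) : nat := #|[set j | e i j]|.

Definition in_triangle (I : finType) (e : rel I) (i : I) : bool :=
  [exists j, exists l, [&& e i j, e i l & e j l]].

Definition triangles_at (X : finType) (r : rel X) (x : X) : {set X * X} :=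
  [set a | [&& r x a.1, r x a.2 & r a.1 a.2]].

(** With [Y = X] this bounds the edges of a relation by its degrees; with
    [Y = X * X] it bounds the triangles by the triangles at each vertex. *)
Lemma card_fibred (X Y : finType) (P : X -> pred Y) (D : nat) :
  (forall x, #|[set y | P x y]| <= D) ->
  #|[set a : X * Y | P a.1 a.2]| <= #|X| * D.
Proof.
move=> PD; rewrite -sum1_card (eq_bigl (fun a => P a.1 a.2)) => [|a]; last first.
  by rewrite inE.
rewrite -(pair_big_dep predT P (fun _ _ => 1)) /= -sum_nat_const.
by apply: leq_sum => x _; rewrite sum1_card; apply: leq_trans (PD x); rewrite cardsE.
Qed.

(** The expected degree of an index is at most [M * D / #|X|], because two distinct
    indices carry independent uniform values. *)
Lemma sum_degree_sample (X : finType) (r : rel X) (D M : nat) (i : 'I_M) :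
  0 < #|X| -> (forall x, #|[set y | r x y]| <= D) ->
  (\sum_(f : {ffun 'I_M -> X}) degree (distinct_close r f) i) * #|X|
  <= M * D * #|X| ^ M.
Proof.
move=> X0 rD.
have -> : \sum_(f : {ffun 'I_M -> X}) degree (distinct_close r f) i
  = \sum_(j : 'I_M) #|[set f : {ffun 'I_M -> X} | distinct_close r f i j]|.
  rewrite (eq_bigr (fun f : {ffun 'I_M -> X} =>
                    \sum_(j < M) (distinct_close r f i j : nat))) => [|f _].
    rewrite exchange_big /=; apply: eq_bigr => j _.
    by rewrite -big_mkcond /= sum1_card cardsE.
  by rewrite -big_mkcond /= sum1_card -cardsE.
rewrite big_distrl /= -mulnA -[M in M * _]card_ord -sum_nat_const.
apply: leq_sum => j _.
have [<- | ij] := eqVneq i j.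
  rewrite (_ : [set f : {ffun _} | _] = set0) ?cards0 ?mul0n //.
  by apply/setP => f; rewrite !inE /distinct_close eqxx.
rewrite -(leq_pmul2r X0) -mulnA mulnn.
rewrite (_ : [set f : {ffun _} | _] = [set f : {ffun 'I_M -> X} | r (f i) (f j)]).
  rewrite marginal2 // card_ord mulnAC leq_mul2r [D * _]mulnC card_fibred //.
  by rewrite orbT.
by apply/setP => f; rewrite !inE /distinct_close ij.
Qed.

(** Union bound over the two other indices of a triangle: an index lies on one
    with probability at most [M ^ 2 * T / #|X| ^ 2]. *)
Lemma card_triangle_sample (X : finType) (r : rel X) (T M : nat) (i : 'I_M) :
  0 < #|X| -> (forall x, #|triangles_at r x| <= T) ->
  #|[set f : {ffun 'I_M -> X} | in_triangle (distinct_close r f) i]| * #|X| ^ 2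
  <= M ^ 2 * T * #|X| ^ M.
Proof.
move=> X0 rT.
pose tri (f : {ffun 'I_M -> X}) j l :=
  let e := distinct_close r f in [&& e i j, e i l & e j l].
have union : #|[set f : {ffun 'I_M -> X} | in_triangle (distinct_close r f) i]|
    <= \sum_(j : 'I_M) \sum_(l : 'I_M) #|[set f | tri f j l]|.
  rewrite -sum1_card
    (eq_bigl (fun f : {ffun 'I_M -> X} => in_triangle (distinct_close r f) i)); last first.
    by move=> f; rewrite inE.
  rewrite (eq_bigr (fun j => \sum_(f : {ffun 'I_M -> X}) \sum_(l : 'I_M) (tri f j l : nat))).
    rewrite exchange_big big_mkcond /=; apply: leq_sum => f _; case: ifP => //.
    case/existsP => j /existsP[l tr].
    by rewrite (bigD1 j) //= (bigD1 l) //= {1}/tri /= tr.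
  move=> j _; rewrite exchange_big /=; apply: eq_bigr => l _.
  by rewrite -big_mkcond /= sum1_card cardsE.
apply: leq_trans (leq_mul union (leqnn _)) _.
rewrite (_ : M ^ 2 * T * _ = #|'I_M| * (#|'I_M| * (T * #|X| ^ M))); last first.
  by rewrite card_ord -mulnn; lia.
rewrite big_distrl /= -!sum_nat_const; apply: leq_sum => j _.
rewrite big_distrl /=; apply: leq_sum => l _.
have [dist | ] := boolP [&& i != j, i != l & j != l]; last first.
  move=> ndist; rewrite (_ : [set f | _] = set0) ?cards0 //.
  apply/setP => f; rewrite !inE /tri /distinct_close; apply: contraNF ndist.
  by case/and3P => /andP[-> _] /andP[-> _] /andP[-> _].
case/and3P: dist => ij il jl.
rewrite -(leq_pmul2r X0) -mulnA -expnSr.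
rewrite (_ : [set f | _] = [set f : {ffun 'I_M -> X} |
    [&& r (f i) (f j), r (f i) (f l) & r (f j) (f l)]]); last first.
  by apply/setP => f; rewrite !inE /tri /distinct_close ij il jl.
rewrite (@marginal3 _ _ (fun x y z => [&& r x y, r x z & r y z])) // card_ord.
rewrite mulnAC leq_mul2r [T * _]mulnC.
by rewrite (@card_fibred _ _ (fun x a => [&& r x a.1, r x a.2 & r a.1 a.2])) ?orbT.
Qed.

(** Deleting the bad indices leaves a triangle-free graph of degree at most [D]. *)
Definition bad_index (I : finType) (D : nat) (e : rel I) (i : I) : bool :=
  (D < degree e i) || in_triangle e i.

(** The threshold [8 * 4 ^ k] is eight times the expected degree, so by Markov's
    inequality it is exceeded with probability at most [1 / 8]; the hypothesis on
    [T] gives the same bound for the probability of lying on a triangle. *)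
Lemma card_bad_sample (X : finType) (r : rel X) (D T M k : nat) (i : 'I_M) :
  0 < #|X| -> 0 < D -> (forall x, #|[set y | r x y]| <= D) ->
  (forall x, #|triangles_at r x| <= T) ->
  8 * 16 ^ k * T <= D ^ 2 -> M * D <= #|X| * 4 ^ k ->
  4 * #|[set f : {ffun 'I_M -> X} | bad_index (8 * 4 ^ k) (distinct_close r f) i]|
  <= #|X| ^ M.
Proof.
move=> X0 D0 rD rT TD MD.
set A := [set f : {ffun 'I_M -> X} | 8 * 4 ^ k < degree (distinct_close r f) i].
set B := [set f : {ffun 'I_M -> X} | in_triangle (distinct_close r f) i].
have -> : [set f : {ffun 'I_M -> X} | bad_index (8 * 4 ^ k) (distinct_close r f) i]
  = A :|: B by apply/setP => f; rewrite !inE.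
have k0 : 0 < 4 ^ k by rewrite expn_gt0.
have leA : 8 * #|A| <= #|X| ^ M.
  have markov : #|A| * (8 * 4 ^ k)
      <= \sum_(f : {ffun 'I_M -> X}) degree (distinct_close r f) i.
    rewrite -sum_nat_const big_mkcond /=; apply: leq_sum => f _.
    by rewrite inE; case: ifP => // /ltnW.
  have := sum_degree_sample i X0 rD; move: (\sum_(f : _) _) markov => s.
  rewrite -(leq_pmul2r X0) => markov /(leq_trans markov) le1.
  have : M * D * #|X| ^ M <= #|X| * 4 ^ k * #|X| ^ M by rewrite leq_mul2r MD orbT.
  have XK0 : 0 < #|X| * 4 ^ k by rewrite muln_gt0 X0.
  move=> /(leq_trans le1) le2; rewrite -(leq_pmul2r XK0); lia.
have leB : 8 * #|B| <= #|X| ^ M.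
  have := card_triangle_sample i X0 rT; rewrite -/B => le1.
  have DX0 : 0 < (#|X| * 4 ^ k) ^ 2 by rewrite expn_gt0 muln_gt0 X0 k0.
  rewrite -(leq_pmul2r DX0).
  have e16 : 16 ^ k = 4 ^ k * 4 ^ k by rewrite -expnMn.
  have le2 : 8 * 16 ^ k * #|B| * #|X| ^ 2 <= M ^ 2 * D ^ 2 * #|X| ^ M.
    apply: (@leq_trans (8 * 16 ^ k * (M ^ 2 * T * #|X| ^ M))).
      by rewrite -mulnA leq_mul2l le1 orbT.
    rewrite mulnA leq_mul2r; apply/orP; right.
    by rewrite mulnCA leq_mul2l TD orbT.
  have le3 : M ^ 2 * D ^ 2 * #|X| ^ M <= (#|X| * 4 ^ k) ^ 2 * #|X| ^ M.
    by rewrite leq_mul2r -expnMn leq_exp2r // MD orbT.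
  have := leq_trans le2 le3; rewrite [in X in _ -> _ <= X]mulnC.
  by rewrite e16 expnMn -!mulnn => H; apply: leq_trans H; apply: eq_leq; lia.
have := cardsU A B; lia.
Qed.

(** At most a quarter of the indices is bad on average, so by Markov's inequality
    more than half of them are bad for at most half of the samples. *)
Lemma many_good_samples (X : finType) (r : rel X) (D T M k : nat) :
  0 < #|X| -> 0 < M -> 0 < D -> (forall x, #|[set y | r x y]| <= D) ->
  (forall x, #|triangles_at r x| <= T) ->
  8 * 16 ^ k * T <= D ^ 2 -> M * D <= #|X| * 4 ^ k ->
  #|X| ^ M <= 2 * #|[set f : {ffun 'I_M -> X} |
     M <= 2 * #|[set i | ~~ bad_index (8 * 4 ^ k) (distinct_close r f) i]|]|.
Proof.
move=> X0 M0 D0 rD rT TD MD.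
pose bad (f : {ffun 'I_M -> X}) := bad_index (8 * 4 ^ k) (distinct_close r f).
set G := [set f : {ffun 'I_M -> X} | _].
have sum_bad : 4 * \sum_(f : {ffun 'I_M -> X}) #|[set i | bad f i]| <= M * #|X| ^ M.
  have -> : \sum_(f : {ffun 'I_M -> X}) #|[set i | bad f i]|
    = \sum_(i < M) #|[set f | bad f i]|.
    rewrite (eq_bigr (fun f => \sum_(i < M) (bad f i : nat))) => [|f _]; last first.
      by rewrite -big_mkcond /= sum1_card cardsE.
    rewrite exchange_big; apply: eq_bigr => i _ /=.
    by rewrite -big_mkcond /= sum1_card cardsE.
  rewrite big_distrr /= -[M in M * _]card_ord -sum_nat_const.
  by apply: leq_sum => i _; apply: card_bad_sample rT TD MD.
have markov : #|~: G| * M <= 2 * \sum_(f : {ffun 'I_M -> X}) #|[set i | bad f i]|.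
  rewrite -sum_nat_const big_distrr big_mkcond /=; apply: leq_sum => f _.
  case: ifP => //; rewrite !inE -ltnNge => /ltnW.
  have := cardsC [set i | bad f i]; rewrite card_ord.
  rewrite (_ : ~: _ = [set i | ~~ bad f i]); last by apply/setP => i; rewrite !inE.
  rewrite /bad; move: #|_| #|_| => a b; lia.
have : 2 * #|~: G| <= #|X| ^ M.
  by rewrite -(leq_pmul2r M0); lia.
have := cardsC G; rewrite card_ffun card_ord.
lia.
Qed.

Lemma good_sample_stable (X I : finType) (r : rel X) (k : nat) (f : I -> X) :
  symmetric r ->
  #|I| <= 2 * #|[set i | ~~ bad_index (8 * 4 ^ k) (distinct_close r f) i]| ->
  exists2 W : {set I}, stable (distinct_close r f) W & #|I| * k <= 128 * 4 ^ k * #|W|.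
Proof.
move=> rs; set S := [set i | _] => le_S.
have es : symmetric (distinct_close r f) by move=> i j; rewrite /distinct_close eq_sym rs.
have ei : irreflexive (distinct_close r f) by move=> i; rewrite /distinct_close eqxx.
have [|||W [_ stW le_W]] := @triangle_free_stable_set _ _ S (8 * 4 ^ k) k es ei.
- move=> i j l; rewrite inE negb_or => /andP[_ +] _ _; apply: contra => tri.
  by apply/existsP; exists j; apply/existsP; exists l.
- move=> i; rewrite inE negb_or -leqNgt => /andP[+ _]; apply: leq_trans.
  by apply: subset_leq_card; apply/subsetP => j; rewrite !inE => /andP[].
- by rewrite leq_pmull.
- by exists W => //; nia.
Qed.

(** Both sides are compared with the falling factorial
    [(2 t) (2 t - 1) ... (t + 1) = 'C(2 t, t) * t`!], whose factors exceed [t]. *)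
Lemma expn_self_le (t : nat) : t ^ t <= 4 ^ t * t`!.
Proof.
have le_ffact m s : m ^ s <= (m + s) ^_ s.
  by elim: s => [|s IH]; rewrite // addnS ffactSS expnS leq_mul // leqW // leq_addr.
have bin_le m s : 'C(m, s) <= 2 ^ m.
  elim: m s => [|m IH] [|s]; rewrite ?bin0 ?expn_gt0 // binS expnS.
  by have := IH s; have := IH s.+1; lia.
apply: leq_trans (le_ffact t t) _; rewrite -bin_ffact leq_mul2r.
by rewrite (_ : 4 ^ t = 2 ^ (t + t)) ?bin_le ?orbT // addnn -mul2n expnM.
Qed.

Lemma bin_expn_self_le (M t : nat) : 'C(M, t) * t ^ t <= (4 * M) ^ t.
Proof.
apply: (@leq_trans ('C(M, t) * (4 ^ t * t`!))); first by rewrite leq_mul2l expn_self_le orbT.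
rewrite mulnCA bin_ffact expnMn leq_mul2l; apply/orP; right.
elim: t M => [|t IH] [|M] //; rewrite ffactSS expnS leq_mul2l /=.
by apply: leq_trans (IH M) _; case: t {IH} => // t; rewrite leq_exp2r.
Qed.

(** Union bound: a sample that contains an independent set of size [t] maps some
    set [W] of [t] indices into some independent set [C] of size [t].  For given
    [W] and [C] this has probability [(t / #|X|) ^ t], and
    [bin_expn_self_le] accounts for the choice of [W].  Counting all maps from [W]
    to [C], instead of the bijections, only costs the factor [4 ^ t]. *)
Lemma card_stable_samples (X : finType) (r : rel X) (M t : nat) :
  reflexive r ->
  #|[set f : {ffun 'I_M -> X} |
      [exists W : {set 'I_M}, (#|W| == t) && stable (distinct_close r f) W]]| * #|X| ^ t
  <= (4 * M) ^ t * #|[set C : {set X} | (#|C| == t) && stable (distinct_close r id) C]|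
     * #|X| ^ M.
Proof.
move=> rr; set F := [set f | _]; set K := [set C : {set X} | _].
have [lt_Mt | le_tM] := ltnP M t.
  suff -> : F = set0 by rewrite cards0.
  apply/setP => f; rewrite !inE; apply/existsP => -[W /andP[/eqP Wt _]].
  by have := max_card (mem W); rewrite Wt card_ord leqNgt lt_Mt.
pose into (W : {set 'I_M}) (C : {set X}) :=
  [set f : {ffun 'I_M -> X} | [forall i in W, f i \in C]].
have cover : #|F| <= \sum_(W : {set 'I_M} | #|W| == t) \sum_(C in K) #|into W C|.
  rewrite -sum1_card.
  rewrite (eq_bigr (fun W => \sum_f \sum_(C in K) (f \in into W C : nat))); last first.
    move=> W _; rewrite exchange_big /=; apply: eq_bigr => C _.
    by rewrite -big_mkcond /= sum1_card.
  rewrite exchange_big big_mkcond /=; apply: leq_sum => f _; case: ifP => //.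
  rewrite inE => /existsP[W /andP[Wt /stableP stW]].
  have injW : {in W &, injective f}.
    move=> i j iW jW eq_f; apply/eqP; move: (stW i j iW jW).
    by rewrite /distinct_close eq_f rr andbT negbK.
  have CK : f @: W \in K.
    rewrite inE card_in_imset // Wt /=; apply/stableP => x y.
    move=> /imsetP[i iW ->] /imsetP[j jW ->]; rewrite /distinct_close /=.
    have := stW i j iW jW; rewrite /distinct_close; apply: contra => /andP[+ ->].
    by rewrite andbT; apply: contraNneq => ->.
  rewrite (bigD1 W) //= (bigD1 (f @: W)) //=.
  by rewrite inE (_ : [forall i in W, _]) //; apply/forall_inP => i; apply: imset_f.
have card_into (W : {set 'I_M}) C : #|W| = t -> C \in K ->
    #|into W C| * #|X| ^ t = t ^ t * #|X| ^ M.
  move=> Wt; rewrite inE => /andP[/eqP Ct _].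
  rewrite /into (@card_ffun_into _ _ W (fun=> C)) prod_nat_const card_ord Wt Ct.
  by rewrite -mulnA -expnD subnK.
apply: leq_trans (leq_mul cover (leqnn _)) _.
rewrite big_distrl /=.
rewrite (eq_bigr (fun=> #|K| * (t ^ t * #|X| ^ M))) => [|W /eqP Wt]; last first.
  by rewrite big_distrl /= -sum_nat_const; apply: eq_bigr => C; apply: card_into.
rewrite sum_nat_const (_ : #|_| = 'C(M, t)); last first.
  by rewrite -[in RHS](card_ord M) -card_draws; apply: eq_card => W; rewrite !inE.
rewrite mulnCA mulnA [X in _ <= X * _]mulnC -!mulnA leq_mul2l mulnA leq_mul2r.
by rewrite bin_expn_self_le !orbT.
Qed.

(** Half of the samples contain an independent set of size [t], whereas
    by [card_stable_samples] each of the [K] independent sets of size [t] accounts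
    for a fraction of at most [(4 * M / #|X|) ^ t <= (2 * 4 ^ k) ^ - t].  Hence
    [2 * K >= (2 * 4 ^ k) ^ t].  The constant [8] in the hypothesis leaves room for
    the factors [4] and [2] here. *)
Lemma many_stable_sets (X : finType) (r : rel X) (D k : nat) :
  0 < #|X| -> 0 < D -> reflexive r -> symmetric r ->
  (forall x, #|[set y | r x y]| = D) ->
  (forall x, 8 * 16 ^ k * #|triangles_at r x| <= D ^ 2) ->
  exists2 t, #|X| * k <= 256 * D * t
    & 4 ^ (k * t) <= #|[set C : {set X} | stable (distinct_close r id) C]|.
Proof.
move=> X0 D0 rr rs rD rT.
have DX : D <= #|X| by case/card_gt0P: X0 => x _; rewrite -(rD x) max_card.
have k0 : 0 < 4 ^ k by rewrite expn_gt0.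
pose M := (#|X| * 4 ^ k) %/ D.
have MD : M * D <= #|X| * 4 ^ k by apply: leq_trunc_div.
have M0 : 0 < M by rewrite divn_gt0 // (leq_trans DX) // leq_pmulr.
have MD2 : #|X| * 4 ^ k <= 2 * M * D.
  by have := ltn_ceil (#|X| * 4 ^ k) D0; rewrite -/M; nia.
pose T := D ^ 2 %/ (8 * 16 ^ k).
have c0 : 0 < 8 * 16 ^ k by rewrite muln_gt0 expn_gt0.
have rT' x : #|triangles_at r x| <= T by rewrite leq_divRL // mulnC.
have TD : 8 * 16 ^ k * T <= D ^ 2 by rewrite mulnC leq_trunc_div.
(* The degenerate triangles [(x, y, y)] alone give [D] pairs at each
   vertex [x], so the sparsity hypothesis bounds [D] from below. *)
have bigD : 8 * 16 ^ k <= D.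
  case/card_gt0P: X0 => x _.
  have : D <= T.
    apply: leq_trans (rT' x); rewrite -(rD x) -(card_imset _ (_ : injective (fun y => (y, y)))).
      by apply/subset_leq_card/subsetP => a /imsetP[y]; rewrite !inE => xy -> /=; rewrite xy rr.
    by move=> y z [].
  by move=> DT; rewrite -(leq_pmul2r D0) mulnn (leq_trans _ TD) // leq_mul2l DT orbT.
have MX : 8 * 4 ^ k * M <= #|X|.
  have e16 : 16 ^ k = 4 ^ k * 4 ^ k by rewrite -expnMn.
  rewrite -(leq_pmul2r k0) (leq_trans _ MD) //.
  by rewrite (_ : _ * _ * _ = M * (8 * 16 ^ k)) ?leq_mul2l ?bigD ?orbT // e16; lia.
have exT : exists t, #|X| * k <= 256 * D * t.
  by exists (#|X| * k); rewrite leq_pmull // muln_gt0.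
(* The least such [t] is at most the size of the independent set found in every
   good sample, hence does not depend on the sample. *)
case: (ex_minnP exT) => t le_t min_t; exists t => //.
case: t le_t min_t => [|t] le_t min_t.
  rewrite muln0; apply/card_gt0P; exists set0; rewrite inE.
  by apply/stableP => x y; rewrite inE.
have good := many_good_samples X0 M0 D0 (fun x => eq_leq (rD x)) rT' TD MD.
have := card_stable_samples M t.+1 rr.
set F := [set f | _]; set K := [set C : {set X} | _] => le_F.
have : #|X| ^ M <= 2 * #|F|.
  apply: leq_trans good _; rewrite leq_mul2l /=.
  apply/subset_leq_card/subsetP => f; rewrite !inE => gf.
  have [|W stW le_W] := @good_sample_stable X 'I_M r k f rs; first by rewrite card_ord.
  rewrite card_ord in le_W.
  have tW : t < #|W|.
    apply: min_t; rewrite -(leq_pmul2r k0) mulnAC.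
    apply: (@leq_trans (2 * M * D * k)); first by rewrite leq_mul2r MD2 orbT.
    rewrite (_ : 2 * M * D * k = 2 * D * (M * k)); last by lia.
    apply: leq_trans (leq_mul (leqnn _) le_W) _; apply: eq_leq; lia.
  have : 0 < #|[set B : {set 'I_M} | B \subset W & #|B| == t.+1]|.
    by rewrite cards_draws bin_gt0.
  case/card_gt0P => B; rewrite inE => /andP[BW Bt].
  by apply/existsP; exists B; rewrite Bt (stable_subset BW).
have XM0 : 0 < #|X| ^ M by rewrite expn_gt0 X0.
move=> le_M; have le_K : #|X| ^ t.+1 <= 2 * ((4 * M) ^ t.+1 * #|K|).
  rewrite -(leq_pmul2r XM0); have := leq_mul le_M (leqnn (#|X| ^ t.+1)).
  by rewrite -!mulnA in le_F *; lia.
have M4 : 0 < (4 * M) ^ t.+1 by rewrite expn_gt0 muln_gt0 M0.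
have : (2 * 4 ^ k) ^ t.+1 <= 2 * #|K|.
  rewrite -(leq_pmul2r M4) -expnMn -[leqRHS]mulnA [#|K| * _]mulnC.
  by apply: leq_trans le_K; rewrite leq_exp2r // (leq_trans _ MX) //; lia.
rewrite expnMn -expnM expnS -mulnA leq_pmul2l // => le_K2.
apply: (@leq_trans #|K|).
  by apply: leq_trans le_K2; rewrite leq_pmull // expn_gt0.
by apply/subset_leq_card/subsetP => C; rewrite !inE => /andP[].
Qed.

(** * Triangles in the Hamming graph *)

Definition close (q n d : nat) : rel (word q n) := fun x y => hamming_dist x y <= d.

Lemma close_refl (q n d : nat) : reflexive (@close q n d).
Proof.
move=> x; rewrite /close /hamming_dist (_ : finset _ = set0) ?cards0 //.
by apply/setP => i; rewrite !inE eqxx.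
Qed.

Lemma close_sym (q n d : nat) : symmetric (@close q n d).
Proof.
move=> x y; rewrite /close /hamming_dist (_ : finset _ = [set i | y i != x i]) //.
by apply/setP => i; rewrite !inE eq_sym.
Qed.

Lemma codes_stableE (q n d : nat) :
  codes q n d.+1 = [set C | stable (distinct_close (@close q n d) id) C].
Proof.
apply/setP => C; rewrite !inE; apply: eq_forallb => x; congr (_ ==> _).
by apply: eq_forallb => y; rewrite /distinct_close /close /= negb_and -implybE -ltnNge.
Qed.

Lemma card_words_differing_on (q n : nat) (x : word q n) (S : {set 'I_n}) :
  #|[set y : word q n | [set i | x i != y i] == S]| = (q - 1) ^ #|S|.
Proof.
pose F i := if i \in S then [set~ x i] else [set x i].
have -> : #|[set y : word q n | [set i | x i != y i] == S]|
        = #|[set y : word q n | [forall i in [set: 'I_n], y i \in F i]]|.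
  apply: eq_card => y; rewrite !inE; apply/eqP/forall_inP => [eqS i _ | h].
    rewrite /F -eqS inE; have [-> | ne] := eqVneq (x i) (y i); first by rewrite inE.
    by rewrite !inE eq_sym.
  apply/setP => i; have := h i (in_setT i); rewrite /F inE eq_sym.
  by case: (i \in S); rewrite !inE // => ->.
rewrite card_ffun_into cardsT subnn muln1 (bigID (mem S)) /=.
rewrite [X in _ * X]big1 => [|i /andP[_ /negPf iS]]; last by rewrite /F iS cards1.
rewrite muln1 (eq_bigr (fun=> q - 1)) => [|i /andP[_ iS]]; last first.
  by rewrite /F iS cardsC1 card_ord subn1.
by rewrite prod_nat_const; congr (_ ^ _); apply: eq_card => i; rewrite unfold_in /= in_setT.
Qed.

Lemma card_ball (q n d : nat) (x : word q n) :
  #|[set y | @close q n d x y]| = vol q n d.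
Proof.
rewrite -sum1_card (partition_big (fun y : word q n => [set i | x i != y i])
                                  (fun S : {set 'I_n} => #|S| <= d)) /=; last first.
  by move=> y; rewrite inE.
rewrite (eq_bigr (fun S : {set 'I_n} => (q - 1) ^ #|S|)) => [|S Sd]; last first.
  rewrite -(card_words_differing_on x) sum1_card.
  apply: eq_card => y; rewrite !inE; apply/andP/idP => [[] // | /eqP yS].
  have hd : hamming_dist x y = #|S| by rewrite -yS.
  by rewrite inE /close hd; split=> //; apply/eqP.
rewrite (partition_big (fun S : {set 'I_n} => inord #|S| : 'I_d.+1) predT) //=.
rewrite /vol big_mkord; apply: eq_bigr => k _.
have eqk (S : {set 'I_n}) : (#|S| <= d) && (inord #|S| == k) = (#|S| == k).
  apply/andP/eqP => [[Sd /eqP <-] | Sk]; first by rewrite inordK.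
  by rewrite Sk -ltnS ltn_ord; split=> //; apply/eqP/val_inj; rewrite /= inordK ?ltn_ord.
rewrite (eq_bigl _ _ eqk) (eq_bigr (fun=> (q - 1) ^ k)) => [|S /eqP -> //].
rewrite sum_nat_const; congr (_ * _).
by rewrite -[n in RHS]card_ord -card_draws; apply: eq_card => S; rewrite !inE.
Qed.

(** The terms [a ^ b / b!] of the series of [exp a] are largest at [b = a]. *)
Lemma fact_expn_le (a b : nat) : a`! * a ^ b <= b`! * a ^ a.
Proof.
have up c s : c`! * c ^ s <= (c + s)`!.
  elim: s => [|s IH]; rewrite ?addn0 ?muln1 // addnS factS expnS mulnCA leq_mul //.
  by rewrite leqW // leq_addr.
have down c s : (c + s)`! <= c`! * (c + s) ^ s.
  elim: s => [|s IH]; rewrite ?addn0 ?muln1 // addnS factS expnS mulnCA leq_mul //.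
  apply: leq_trans IH _; rewrite leq_mul2l; apply/orP; right.
  by case: s => // s; rewrite leq_exp2r.
have [ab | /ltnW ba] := leqP a b.
  by rewrite -(subnKC ab) expnD mulnCA [leqRHS]mulnC leq_mul2l up orbT.
have := down b (a - b); rewrite subnKC // => le_a.
by rewrite -{4}(subnK ba) expnD mulnA leq_mul2r le_a orbT.
Qed.

(** The binomial distribution with parameters [n] and [d / n] has its mode at [d]:
    the [n + 1] terms of the expansion of [((n - d) + d) ^ n] are at most the
    [d]-th one, by [fact_expn_le] for [d] and for [n - d]. *)
Lemma binomial_mode (n d : nat) : d <= n ->
  n ^ n <= n.+1 * ('C(n, d) * (d ^ d * (n - d) ^ (n - d))).
Proof.
move=> dn; rewrite -{1}(subnK dn) expnDn -[n.+1 in leqRHS]card_ord -sum_nat_const.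
apply: leq_sum => k _; have kn : k <= n by rewrite -ltnS ltn_ord.
have F0 : 0 < d`! * (n - d)`! * (k`! * (n - k)`!) by rewrite !muln_gt0 !fact_gt0.
rewrite -(leq_pmul2r F0).
have bd := bin_fact dn; have bk := bin_fact kn.
have := leq_mul (fact_expn_le d k) (fact_expn_le (n - d) (n - k)).
move: (d`!) (k`!) ((n - d)`!) ((n - k)`!) ('C(n, d)) ('C(n, k)) (n`!) bd bk.
move=> d1 k1 d2 k2 bd bk nf ed ek.
move: (d ^ k) (d ^ d) ((n - d) ^ (n - k)) ((n - d) ^ (n - d)) => dk dd ek' ed'.
move=> le1.
apply: leq_trans (eq_leq _) (leq_trans (leq_mul (leqnn nf) le1) (eq_leq _)).
  by rewrite -ek; lia.
by rewrite -ed; lia.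
Qed.

Local Open Scope ring_scope.

Lemma prod_agree (R : comPzRingType) (q n : nat) (x y : word q n) (a b : R) :
  \prod_(i < n) (if x i == y i then a else b)
  = a ^+ (n - hamming_dist x y) * b ^+ hamming_dist x y.
Proof.
rewrite (bigID (fun i => x i == y i)) /=; congr (_ * _).
  rewrite (eq_bigr (fun=> a)) => [|i -> //]; rewrite prodr_const; congr (_ ^+ _).
  have := cardsC [set i | x i != y i]; rewrite card_ord => /(congr1 (subn^~ (hamming_dist x y))).
  by rewrite /hamming_dist addKn => <-; apply: eq_card => i; rewrite !inE negbK.
rewrite (eq_bigr (fun=> b)) => [|i /negPf -> //]; rewrite prodr_const; congr (_ ^+ _).
by apply: eq_card => i; rewrite !inE.
Qed.

(** Within the ball of radius [d] the product weight is least on the boundary. *)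
Lemma prod_agree_ge (R : realFieldType) (q n d : nat) (x y : word q n) (a b : R) :
  0 <= b -> b <= a -> (d <= n)%N -> close d x y ->
  a ^+ (n - d) * b ^+ d <= \prod_(i < n) (if x i == y i then a else b).
Proof.
move=> b0 ba dn; rewrite /close prod_agree; move: (hamming_dist x y) => h hd.
have a0 := le_trans b0 ba.
have -> : (n - h)%N = ((n - d) + (d - h))%N by lia.
rewrite -{2}(subnK hd) !exprD -!mulrA ler_wpM2l ?exprn_ge0 //.
by rewrite ler_wpM2r ?exprn_ge0 // lerXn2r.
Qed.

(** The weights are products over the coordinates, so the double sum is the [n]-th
    power of the sum for one coordinate, which splits according to whether the two
    letters agree. *)
Lemma tilted_pair_sum (R : comPzRingType) (q n : nat) (x : word q n) (a b u : R) :
  \sum_(y : word q n) \sum_(z : word q n)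
     \prod_(i < n) ((if x i == y i then a else b) * (if x i == z i then a else b)
                    * (if y i == z i then 1 else u))
  = (u * (a + b *+ (q - 1)) ^+ 2 + (1 - u) * (a ^+ 2 + b ^+ 2 *+ (q - 1))) ^+ n.
Proof.
pose w i (c : 'I_q) := if x i == c then a else b.
have inner (y : word q n) : \sum_(z : word q n) \prod_(i < n)
    (w i (y i) * w i (z i) * (if y i == z i then 1 else u))
  = \prod_(i < n) \sum_(e : 'I_q) (w i (y i) * w i e * (if y i == e then 1 else u)).
  by rewrite bigA_distr_bigA.
rewrite (eq_bigr _ (fun y _ => inner y)).
rewrite -(bigA_distr_bigA (fun i c => \sum_(e : 'I_q) (w i c * w i e * (if c == e then 1 else u)))).
rewrite -[n in RHS]card_ord -prodr_const; apply: eq_bigr => i _.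
have sumw (f : R -> R) : \sum_(c : 'I_q) f (w i c) = f a + f b *+ (q - 1).
  rewrite (bigD1 (x i)) //= /w eqxx; congr (_ + _).
  rewrite (eq_bigr (fun=> f b)) => [|c]; last by rewrite eq_sym => /negPf ->.
  by rewrite sumr_const cardC1 card_ord subn1.
have per c : \sum_(e : 'I_q) w i c * w i e * (if c == e then 1 else u)
           = u * (a + b *+ (q - 1)) * w i c + (1 - u) * w i c ^+ 2.
  rewrite -(sumw id) (bigD1 c) //= eqxx mulr1 [in RHS](bigD1 c) //= mulrDr mulrDl.
  rewrite (eq_bigr (fun e => u * w i c * w i e)) => [|e]; last first.
    by rewrite eq_sym => /negPf ->; ring.
  by rewrite -mulr_sumr; ring.
rewrite (eq_bigr _ (fun c _ => per c)) big_split /= -!mulr_sumr (sumw id).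
by rewrite (sumw (fun t => t ^+ 2)) -mulrA -expr2.
Qed.

(** Each triangle at [x] contributes to the sum of [tilted_pair_sum] at least
    its value for three pairwise distances equal to [d]. *)
Lemma card_triangles_le (R : realFieldType) (q n d : nat) (x : word q n) (a b u : R) :
  0 <= b -> b <= a -> 0 <= u -> u <= 1 -> (d <= n)%N ->
  #|triangles_at (@close q n d) x|%:R * ((a ^+ (n - d) * b ^+ d) ^+ 2 * u ^+ d)
  <= (u * (a + b *+ (q - 1)) ^+ 2 + (1 - u) * (a ^+ 2 + b ^+ 2 *+ (q - 1))) ^+ n.
Proof.
move=> b0 ba u0 u1 dn; rewrite -(tilted_pair_sum x).
rewrite pair_big /= mulr_natl -sumr_const.
have a0 := le_trans b0 ba.
have w0 y i : 0 <= (if x i == y then a else b) by case: ifP.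
rewrite [leRHS](bigID (mem (triangles_at (@close q n d) x))) /=.
rewrite -[leLHS]addr0; apply: lerD; last first.
  apply: sumr_ge0 => yz _; apply: prodr_ge0 => i _.
  by rewrite !mulr_ge0 //; case: ifP.
apply: ler_sum => -[y z]; rewrite inE /= => /and3P[xy xz yz].
rewrite !big_split /= expr2 !ler_pM ?mulr_ge0 ?exprn_ge0 //; try exact: prod_agree_ge.
have := prod_agree_ge u0 u1 dn yz.
by rewrite expr1n mul1r.
Qed.

(** The probability that a binomial variable with parameters [n] and [p] equals
    [d = p n] is at least [1 / (n + 1)], and there are at most [vol q n d] words
    at distance exactly [d] from a given one. *)
Lemma vol_tilted_ge (R : realFieldType) (q n d : nat) (p : R) :
  (2 <= q)%N -> (d <= n)%N -> d%:R = p * n%:R ->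
  1 <= n.+1%:R * (vol q n d)%:R * ((1 - p) ^+ (n - d) * (p / (q - 1)%:R) ^+ d).
Proof.
move=> q2 dn dE.
have s0 : (q - 1)%:R != 0 :> R by rewrite pnatr_eq0; lia.
have nn0 : 0 < n%:R ^+ n :> R by rewrite -natrX ltr0n expn_gt0; case: (n).
have ndE : (n - d)%:R = (1 - p) * n%:R :> R by rewrite natrB // dE; ring.
have w0 : n%:R ^+ n * ((1 - p) ^+ (n - d) * (p / (q - 1)%:R) ^+ d)
        = (n - d)%:R ^+ (n - d) * d%:R ^+ d / (q - 1)%:R ^+ d :> R.
  rewrite -{2}(subnK dn) exprD ndE dE !exprMn exprVn; ring.
have volC : ('C(n, d) * (q - 1) ^ d <= vol q n d)%N.
  by rewrite /vol big_nat_recr //= leq_addl.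
rewrite -(ler_pM2l nn0) mulr1 mulrCA w0.
have := binomial_mode dn; rewrite -(ler_nat R) natrX => /le_trans; apply.
rewrite natrM -[leRHS]mulrA ler_wpM2l //.
have sd0 : 0 < (q - 1)%:R ^+ d :> R by rewrite exprn_gt0 // ltr0n; lia.
rewrite mulrA ler_pdivlMr // -!natrX -!natrM ler_nat.
by rewrite mulnAC leq_mul // mulnC.
Qed.

(** In [card_triangles_le] take for [a] and [b] the probabilities [1 - p] and
    [p / (q - 1)], and let [sigma] be the probability that two independent random
    letters agree.  With [u = 1 / (1 + tau)] the bound becomes the [n]-th power of
    [(1 + tau) ^ p * (1 - (1 - sigma) * tau / (1 + tau))].  To first order in
    [tau] this is [1 - (1 - sigma - p) * tau], and [p < 1 - sigma] is exactly the
    hypothesis [p < (q - 1) / q]; so it is less than [1] for small [tau]. *)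
Lemma local_sparsity (R : realType) (q : nat) (p : R) :
  (2 <= q)%N -> 0 < p -> p < (q%:R - 1) / q%:R ->
  exists2 kappa : R, 0 < kappa & forall n d (x : word q n), d%:R = p * n%:R ->
    #|triangles_at (@close q n d) x|%:R
      <= n.+1%:R ^+ 2 * expR (- (kappa * n%:R)) * (vol q n d)%:R ^+ 2.
Proof.
move=> q2 p0 pq.
have sE : (q - 1)%:R = q%:R - 1 :> R by rewrite natrB //; lia.
have q0 : 2 <= q%:R :> R by rewrite (ler_nat _ 2).
pose s : R := q%:R - 1.
have s1 : 1 <= s by rewrite /s; lra.
have ps : p * (s + 1) < s by move: pq; rewrite ltr_pdivlMr /s; lra.
have p1 : p < 1 by nra.
pose b := p / s; have bs : b * s = p by rewrite /b divfK; lra.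
have b0 : 0 <= b by rewrite divr_ge0; lra.
have ba : b <= 1 - p by nra.
pose sigma := (1 - p) ^+ 2 + b ^+ 2 *+ (q - 1).
have sigmaE : sigma = (1 - p) ^+ 2 + b * p.
  by rewrite /sigma -mulr_natr sE -/s expr2 -mulrA bs.
have gap : p < 1 - sigma by rewrite sigmaE; nra.
have sigma0 : 0 <= sigma by rewrite sigmaE addr_ge0 ?sqr_ge0 // mulr_ge0 // ltW.
(* Chosen so that [p * (1 + tau)] is halfway between [p] and [1 - sigma]. *)
pose tau := (1 - sigma - p) / (2 * p).
have tau0 : 0 < tau by rewrite divr_gt0; lra.
have ptau : p * tau = (1 - sigma - p) / 2 by rewrite /tau; field; lra.
pose u := (1 + tau)^-1.
have u0 : 0 < u by rewrite invr_gt0; lra.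
have ue : u * (1 + tau) = 1 by rewrite mulVf; lra.
have u1 : u <= 1 by nra.
pose kappa := tau * ((1 - sigma) * u - p).
have kappa0 : 0 < kappa by rewrite mulr_gt0 // subr_gt0 -[p]mulr1 -ue; nra.
exists kappa => // n d x dE.
have dn : (d <= n)%N by rewrite -(ler_nat R) dE ler_piMl // ltW.
have := card_triangles_le x b0 ba (ltW u0) u1 dn.
have := vol_tilted_ge q2 dn dE; rewrite sE -/s -/b.
rewrite -/sigma -[b *+ _]mulr_natr sE -/s bs subrK expr1n mulr1.
set w := (1 - p) ^+ (n - d) * b ^+ d; set T := #|_|%:R; set V := (vol q n d)%:R => vw Tw.
have T0 : 0 <= T by rewrite ler0n.
have V0 : 0 <= V by rewrite ler0n.
have w0 : 0 <= w by rewrite mulr_ge0 ?exprn_ge0 //; lra.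
have base : u + (1 - u) * sigma <= expR (- (tau * ((1 - sigma) * u))).
  apply: le_trans (expR_ge1Dx _).
  rewrite (_ : 1 - u = u * tau); last by rewrite -[1 in LHS]ue; ring.
  by rewrite -[X in _ <= X + _]ue; lra.
have base0 : 0 <= u + (1 - u) * sigma by rewrite addr_ge0 ?mulr_ge0 //; lra.
have ud : 1 <= u ^+ d * expR (tau * p * n%:R).
  have e1 : (1 + tau) ^+ d <= expR (tau * p * n%:R).
    rewrite (_ : tau * p * n%:R = d%:R * tau); last by rewrite dE; ring.
    by rewrite expRM_natl lerXn2r ?nnegrE ?expR_ge0 ?expR_ge1Dx // addr_ge0 // ltW.
  rewrite -[leLHS](expr1n _ d) -{1}ue exprMn.
  by apply: ler_wpM2l e1; rewrite exprn_ge0 // ltW.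
have right : (u + (1 - u) * sigma) ^+ n <= expR (- (tau * ((1 - sigma) * u)) * n%:R).
  by rewrite expRM_natr lerXn2r ?nnegrE ?expR_ge0.
pose E := expR (tau * p * n%:R).
have E0 : 0 <= E by apply: expR_ge0.
have vw2 : 1 <= (n.+1%:R * V * w) ^+ 2 by rewrite exprn_ege1.
have le1 : T * (w ^+ 2 * u ^+ d) * E <= expR (- (kappa * n%:R)).
  apply: le_trans (ler_wpM2r E0 (le_trans Tw right)) _.
  by rewrite -expRD le_eqVlt (_ : _ + _ = - (kappa * n%:R)) ?eqxx // /kappa; ring.
have le2 : T * w ^+ 2 <= expR (- (kappa * n%:R)).
  apply: le_trans le1; rewrite [leRHS](_ : _ = T * w ^+ 2 * (u ^+ d * E)); last by ring.
  by rewrite ler_peMr // mulr_ge0 // exprn_ge0.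
apply: (@le_trans _ _ (T * (n.+1%:R * V * w) ^+ 2)); first by rewrite ler_peMr.
rewrite (_ : T * _ = (n.+1%:R ^+ 2 * V ^+ 2) * (T * w ^+ 2)); last by ring.
rewrite [leRHS](_ : _ = (n.+1%:R ^+ 2 * V ^+ 2) * expR (- (kappa * n%:R))); last by ring.
by rewrite ler_wpM2l // mulr_ge0 // exprn_ge0.
Qed.

(** * The number of codes *)

Lemma expR_half_le2 (R : realType) : expR (2^-1 : R) <= 2.
Proof.
have := expR_ge1Dx (- 2^-1 : R); rewrite expRN.
have := expR_gt0 (2^-1 : R); move: (expR _) => e e0 h.
have : (1 - 2^-1) * e <= 1 by rewrite -ler_pdivlMr // mul1r.
lra.
Qed.

Lemma exp_beats_square (R : realType) (a : R) : 0 < a ->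
  exists m, forall n, (m <= n)%N -> 8 * n.+1%:R ^+ 2 <= expR (a * n%:R).
Proof.
move=> a0.
(* [exp (a * n) = exp (a * n / 3) ^ 3] is at least [(a * n / 3) ^ 3], and the
   left-hand side is at most [32 * n ^ 2]: note that [864 = 27 * 32]. *)
pose B := 864 / a ^+ 3.
have B0 : 0 < B by rewrite divr_gt0 // exprn_gt0.
exists (Num.bound B).+1 => n mn.
have nB : B <= n%:R.
  apply: le_trans (ltW (archi_boundP (ltW B0))) _.
  by rewrite ler_nat ltnW.
have n1 : 1 <= n%:R :> R by rewrite (ler_nat _ 1); apply: leq_trans mn.
have -> : a * n%:R = 3%:R * (a * n%:R / 3) by field.
rewrite expRM_natl.
have t0 : 0 <= a * n%:R / 3 by rewrite divr_ge0 // mulr_ge0 // ltW.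
apply: (@le_trans _ _ ((a * n%:R / 3) ^+ 3)); last first.
  rewrite lerXn2r ?nnegrE ?expR_ge0 //.
  by apply: le_trans (expR_ge1Dx _); lra.
have aB : 864 <= a ^+ 3 * n%:R by rewrite mulrC -ler_pdivrMr // exprn_gt0.
have -> : (a * n%:R / 3) ^+ 3 = (a ^+ 3 * n%:R) * n%:R ^+ 2 / 27 by field.
have n2 : n.+1%:R ^+ 2 <= 4 * n%:R ^+ 2 :> R by rewrite -natr1; nra.
have : 864 * n%:R ^+ 2 <= a ^+ 3 * n%:R * n%:R ^+ 2 by rewrite ler_wpM2r // sqr_ge0.
lra.
Qed.

Lemma two_codes (q n d : nat) : (0 < q)%N -> (2 <= #|codes q n d.+1|)%N.
Proof.
case: q => // q _; pose x : word q.+1 n := [ffun=> ord0].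
have ne : set0 != [set x] by rewrite eq_sym; apply/set0Pn; exists x; rewrite inE.
have -> : 2%N = #|[set set0; [set x]]| by rewrite cards2 ne.
apply/subset_leq_card/subsetP => C; rewrite codes_stableE !inE.
move=> /orP[] /eqP ->; apply/stableP => y z; rewrite !inE //.
by move=> /eqP -> /eqP ->; rewrite /distinct_close eqxx.
Qed.

Theorem theorem2p5 (R : realType) (q : nat) (p : R) :
  (2 <= q)%N -> 0 < p -> p < (q%:R - 1) / q%:R ->
  exists c : R, 0 < c /\
    forall n d : nat, (0 < n)%N -> d%:R = p * n%:R ->
      expR (c * n%:R ^+ 2 * (q%:R ^+ n / (vol q n d)%:R))
        <= #|codes q n d.+1|%:R.
Proof.
move=> q2 p0 pq.
have q0 : (0 < q)%N by lia.
have p1 : p < 1.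
  apply: lt_trans pq _; rewrite ltr_pdivrMr ?ltr0n //; lra.
have [kappa kappa0 sparse] := local_sparsity q2 p0 pq.
(* With [k] about [g * n], the factor [16 ^ k <= exp (4 g n)] uses up only half of
   the gain [exp (- kappa n)]; the other half absorbs [8 * (n + 1) ^ 2]. *)
pose g := kappa / 8; have g0 : 0 < g by rewrite divr_gt0.
have [m1 large1] := exp_beats_square (divr_gt0 kappa0 (ltr0n R 2)).
(* From [m] on, also [g * n >= 2], so that rounding [g * n] down to [k] loses at
   most a factor [2]. *)
pose m := (maxn m1 (Num.bound (2 / g))).+1.
pose c := Num.min (g ^+ 2 / 1024) (2 * m%:R ^+ 2 * q%:R ^+ m)^-1.
have qm0 : 0 < 2 * m%:R ^+ 2 * q%:R ^+ m :> R.
  by rewrite !mulr_gt0 ?exprn_gt0 ?ltr0n.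
have c0 : 0 < c by rewrite lt_min invr_gt0 qm0 divr_gt0 // exprn_gt0.
exists c; split=> // n d n0 dE.
have dn : (d <= n)%N by rewrite -(ler_nat R) dE ler_piMl // ltW.
have V0 : (0 < vol q n d)%N by rewrite /vol big_nat_recl //= bin0.
have V0R : 0 < (vol q n d)%:R :> R by rewrite ltr0n.
have [lt_nm | le_mn] := ltnP n m.
  (* The second term of the minimum defining [c] makes the exponent at most [1 / 2]. *)
  apply: (@le_trans _ _ 2); last by rewrite (ler_nat _ 2) two_codes.
  apply: le_trans (expR_half_le2 R); rewrite ler_expR.
  apply: (@le_trans _ _ ((2 * m%:R ^+ 2 * q%:R ^+ m)^-1 * (m%:R ^+ 2 * q%:R ^+ m))).
    rewrite -mulrA; apply: ler_pM; rewrite ?mulr_ge0 ?invr_ge0 ?exprn_ge0 ?(ltW c0) //.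
      by rewrite /c ge_min lexx orbT.
    apply: ler_pM; rewrite ?divr_ge0 ?exprn_ge0 //.
      by rewrite lerXn2r ?nnegrE // ler_nat ltnW.
    apply: (@le_trans _ _ (q%:R ^+ n)).
      by rewrite ler_pdivrMr // ler_peMr ?exprn_ge0 // (ler_nat _ 1).
    by rewrite -!natrX ler_nat leq_pexp2l // ltnW.
  rewrite -mulrA invfM -mulrA mulVf ?mulr1 //.
  by rewrite mulf_neq0 // expf_neq0 // pnatr_eq0; lia.
pose k := Num.truncn (g * n%:R).
have gn0 : 0 <= g * n%:R by rewrite mulr_ge0 // ltW.
have kle : k%:R <= g * n%:R by rewrite truncn_le.
have kge : g * n%:R / 2 <= k%:R.
  have : g * n%:R < k.+1%:R by rewrite truncnS_gt.
  have : 2 <= g * n%:R.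
    rewrite mulrC -ler_pdivrMr //.
    apply: le_trans (ltW (archi_boundP (ltW (divr_gt0 (ltr0n R 2) g0)))) _.
    by rewrite ler_nat (leq_trans (leq_maxr m1 _)) // ltnW.
  by rewrite -(natr1 k); lra.
have two_le_e : 2 <= expR 1 :> R by have := expR_ge1Dx (1 : R); lra.
have sixteen : 16 ^+ k <= expR (kappa / 2 * n%:R).
  apply: (@le_trans _ _ (expR (4%:R * k%:R))).
    rewrite expRM_natr lerXn2r ?nnegrE ?expR_ge0 //.
    rewrite -[4%:R]mulr1 expRM_natl (_ : 16 = 2 ^+ 4 :> R); last by rewrite -natrX.
    by rewrite lerXn2r ?nnegrE ?expR_ge0.
  by rewrite ler_expR; move: kle; rewrite /g; lra.
have sparse_nat x : (8 * 16 ^ k * #|triangles_at (@close q n d) x| <= vol q n d ^ 2)%N.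
  rewrite -(ler_nat R) !natrM !natrX.
  have := sparse n d x dE.
  have := large1 n (leq_trans (leq_maxl _ _) (ltnW le_mn)).
  set V := (vol q n d)%:R; set T := #|_|%:R; set E := expR (- _).
  set H := expR (kappa / 2 * n%:R) in sixteen *.
  have EH : E * H * H = 1 by rewrite -!expRD -[RHS](expR0 R); congr expR; field.
  move=> le8 leT.
  have H0 : 0 <= H by apply: expR_ge0.
  have E0 : 0 <= E by apply: expR_ge0.
  have le1 : 8 * 16 ^+ k * T <= 8 * H * (n.+1%:R ^+ 2 * E * V ^+ 2).
    by apply: ler_pM; rewrite ?mulr_ge0 ?exprn_ge0 // ler_wpM2l.
  apply: le_trans le1 _.
  rewrite [leLHS](_ : _ = (8 * n.+1%:R ^+ 2) * (E * H * V ^+ 2)); last by ring.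
  apply: le_trans (ler_wpM2r _ le8) _; first by rewrite !mulr_ge0 // exprn_ge0.
  rewrite [leLHS](_ : _ = E * H * H * V ^+ 2); last by ring.
  by rewrite EH mul1r.
have cardX : #|word q n| = (q ^ n)%N by rewrite card_ffun !card_ord.
have X0 : (0 < #|word q n|)%N by rewrite cardX expn_gt0 q0.
have [t] := many_stable_sets X0 V0 (@close_refl q n d) (@close_sym q n d)
              (@card_ball q n d) sparse_nat.
rewrite -codes_stableE cardX => le_t le_codes.
apply: (@le_trans _ _ (4 ^+ (k * t))); last by rewrite -natrX ler_nat.
have e_le4 : expR 1 <= 4 :> R.
  have -> : expR 1 = expR 2^-1 ^+ 2 :> R by rewrite -expRM_natl mulfV ?pnatr_eq0.
  rewrite (_ : 4 = 2 ^+ 2 :> R); last by rewrite -natrX.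
  by rewrite lerXn2r ?nnegrE ?expR_ge0 ?expR_half_le2.
apply: (@le_trans _ _ (expR ((k * t)%:R))); last first.
  by rewrite -[(k * t)%:R]mulr1 expRM_natl lerXn2r ?nnegrE ?expR_ge0.
rewrite ler_expR natrM.
have : (q ^ n * k)%:R <= (256 * vol q n d * t)%:R :> R by rewrite ler_nat.
rewrite !natrM natrX.
set Q := q%:R ^+ n; set V := (vol q n d)%:R => le_QV.
have QV0 : 0 <= Q / V by rewrite divr_ge0 ?exprn_ge0.
have le_QVt : Q / V * k%:R <= 256 * t%:R.
  by rewrite mulrAC ler_pdivrMr //; lra.
have cg : c <= g ^+ 2 / 1024 by rewrite /c ge_min lexx.
apply: (@le_trans _ _ (g ^+ 2 / 1024 * n%:R ^+ 2 * (Q / V))).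
  by rewrite ler_wpM2r // ler_wpM2r // exprn_ge0.
have le_kk : (g * n%:R / 2) ^+ 2 <= k%:R ^+ 2.
  by rewrite lerXn2r ?nnegrE // divr_ge0.
have k0 : 0 <= k%:R :> R by rewrite ler0n.
have := ler_wpM2l QV0 le_kk; have := ler_wpM2l k0 le_QVt.
nra.
Qed.
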